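(* Let $p\in(0,1)$ and $\Psi(f)=\int_{\mathbb R^d}[f(x)]^p\,dx$. There exists $c>0$ such that for any $\vec\beta\in(0,\infty)^d$, $\vec L\in(0,\infty)^d$ and $\vec r\in[1,\infty]^d$, $$\liminf_{n\to\infty}\ [\ln n]^{2p}\ \inf_{\widetilde F}\ \sup_{f\in\mathcal F_\Psi\cap\mathbb N_{\vec r,d}(\vec\beta,\vec L)}\Big(\mathbb E_f\big[(\widetilde F-\Psi(f))^2\big]\Big)^{1/2}\ \ge\ c .$$
   Context: One observes i.i.d. vectors $X_1,\dots,X_n\in\mathbb R^d$ with common probability density $f$; $X^{(n)}=(X_1,\dots,X_n)$ and $\mathbb E_f$ is expectation under $f$. The infimum is over all estimators, i.e. real-valued measurable functions $\widetilde F$ of $X^{(n)}$; the supremum is over probability densities $f$ in the indicated class. $\mathcal F_\Psi:=\{f:|\Psi(f)|<\infty\}$. For $G:\mathbb R^d\to\mathbb R$, $u\in\mathbb R$ and the canonical basis $e_1,\dots,e_d$, put $\Delta_{u,j}G(x)=G(x+ue_j)-G(x)$ and, inductively, $\Delta^k_{u,j}G=\Delta_{u,j}\Delta^{k-1}_{u,j}G$. The anisotropic Nikolskii class $\mathbb N_{\vec r,d}(\vec\beta,\vec L)$ is the set of functions $G:\mathbb R^d\to\mathbb R$ such that for every $j=1,\dots,d$: $\|G\|_{r_j}\le L_j$, and there exists a natural number $k_j>\beta_j$ with $\|\Delta^{k_j}_{u,j}G\|_{r_j}\le L_j|u|^{\beta_j}$ for all $u\in\mathbb R$ ($\|\cdot\|_s$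 is the $\mathbb L_s(\mathbb R^d)$-norm).
   Formalization: The formal theorem assumes L_j ≥ 1 whenever r_j = 1 (and d ≥ 1): if r_j = 1 and L_j < 1, every density has L_1-norm 1 > L_j, so the class is empty and the displayed lower bound fails. *)

(* Defs.v *)
From HB Require Import structures.
From mathcomp Require Import all_boot all_order all_algebra.
From mathcomp Require Import all_classical all_reals all_analysis.

Set Implicit Arguments.
Unset Strict Implicit.
Unset Printing Implicit Defensive.
Import Order.TTheory GRing.Theory Num.Theory.
Import numFieldNormedType.Exports.

Local Open Scope classical_set_scope.
Local Open Scope ring_scope.

Section cons_pair.
Context d (T : measurableType d) (n : nat).

Definition cons_pair (z : T * n.-tuple T) : n.+1.-tuple T :=
  [the n.+1.-tuple T of z.1 :: z.2].

Lemma measurable_cons_pair : measurable_fun setT cons_pair.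
Proof. by apply: measurable_cons. Qed.

End cons_pair.

Section power_step.
Context d (T : measurableType d) (R : realType).
Variable mu : {sigma_finite_measure set T -> \bar R}.
Variable n : nat.
Variable nu : {sigma_finite_measure set (n.-tuple T) -> \bar R}.
Local Open Scope ereal_scope.

Definition power_step : set (n.+1.-tuple T) -> \bar R :=
  pushforward (mu \x nu) (@cons_pair _ T n).

Let power_step0 : power_step set0 = 0.
Proof. by rewrite /power_step /pushforward preimage_set0 measure0. Qed.

Let power_step_ge0 A : 0 <= power_step A.
Proof. exact: (measure_ge0 (mu \x nu)). Qed.

Let mcons_pre A : measurable A -> measurable (@cons_pair _ T n @^-1` A).
Proof.
by move=> mA; rewrite -[X in measurable X]setTI; exact: measurable_cons_pair.
Qed.

Let power_step_sigma_additive : semi_sigma_additive power_step.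
Proof.
move=> F mF tF mUF; rewrite /power_step /pushforward preimage_bigcup.
apply: measure_semi_sigma_additive.
- by move=> k; exact: mcons_pre.
- apply/trivIsetP => /= i j _ _ ij; rewrite -preimage_setI.
  by move/trivIsetP : tF => /(_ _ _ _ _ ij) ->//; rewrite preimage_set0.
- by rewrite -preimage_bigcup; exact: mcons_pre.
Qed.

HB.instance Definition _ := isMeasure.Build _ _ _ power_step
  power_step0 power_step_ge0 power_step_sigma_additive.

Let power_step_sigma_finite : sigma_finite setT power_step.
Proof.
have /sigma_finiteP[F [FT ndF Foo]] := sigma_finiteT mu.
have /sigma_finiteP[G [GT ndG Goo]] := sigma_finiteT nu.
pose unc (t : n.+1.-tuple T) : T * n.-tuple T := (thead t, [tuple of behead t]).
have munc : measurable_fun setT unc.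
  apply/measurable_fun_pairP; split.
    exact: measurable_tnth.
  exact: measurable_behead.
have consK z : unc (cons_pair z) = z.
  by case: z => x t; congr pair; apply/val_inj.
exists (fun k => unc @^-1` (F k `*` G k)).
  apply/esym; rewrite -subTset => t _.
  have [i _ Fi] : (\bigcup_i F i) (unc t).1 by rewrite -FT.
  have [j _ Gj] : (\bigcup_i G i) (unc t).2 by rewrite -GT.
  exists (maxn i j) => //; split.
  - by move: Fi; exact/subsetPset/ndF/leq_maxl.
  - by move: Gj; exact/subsetPset/ndG/leq_maxr.
move=> k; have [mF Fk] := Foo k; have [mG Gk] := Goo k; split.
  by rewrite -[X in measurable X]setTI; apply: munc => //; exact: measurableX.
rewrite /power_step /pushforward.
have -> : @cons_pair _ T n @^-1` (unc @^-1` (F k `*` G k)) = F k `*` G k.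
  apply/funext => z.
  by rewrite -[in RHS](consK z).
by rewrite product_measure1E// lte_mul_pinfty// ge0_fin_numE.
Qed.

HB.instance Definition _ := Measure_isSigmaFinite.Build _ _ _ power_step
  power_step_sigma_finite.

End power_step.

(* The n-fold product of mu, on the product sigma-algebra of n.-tuple T. *)
Fixpoint power_measure d (T : measurableType d) (R : realType)
    (mu : {sigma_finite_measure set T -> \bar R}) (n : nat) :
    {sigma_finite_measure set (n.-tuple T) -> \bar R} :=
  match n with
  | 0 => \d_([tuple] : 0.-tuple T)
  | m.+1 => power_step mu (power_measure mu m)
  end.

Lemma power_measure_setT d (T : measurableType d) (R : realType)
    (mu : {sigma_finite_measure set T -> \bar R}) (n : nat) :
  mu setT = 1%E -> power_measure mu n setT = 1%E.
Proof.
move=> mu1; elim: n => [|n ih] /=; first by rewrite diracT.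
rewrite /power_step /pushforward preimage_setT -setXTT.
transitivity (mu setT * power_measure mu n setT)%E.
  exact: product_measure1E.
by rewrite mu1 ih mule1.
Qed.

(* Values on measurable boxes characterise the product measure. *)
Lemma power_measure_box d (T : measurableType d) (R : realType)
    (mu : {sigma_finite_measure set T -> \bar R}) (n : nat)
    (A : 'I_n -> set T) : (forall i, measurable (A i)) ->
  power_measure mu n [set t | forall i, A i (tnth t i)] =
  (\prod_(i < n) mu (A i))%E.
Proof.
elim: n A => [|n ih] A mA /=.
  by rewrite big_ord0 diracE mem_set//= => -[].
have mB : measurable [set t : n.-tuple T | forall i, A (lift ord0 i) (tnth t i)].
  rewrite (_ : mkset _ = \bigcap_(i in [set: 'I_n])
      ((@tnth _ T ^~ i) @^-1` A (lift ord0 i))).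
    apply: fin_bigcap_measurable => // i _.
    by rewrite -[X in measurable X]setTI; exact: measurable_tnth.
  by apply/seteqP; split=> t H i => [_|]; [exact: (H i)|exact: (H i I)].
rewrite big_ord_recl -(ih (fun i => A (lift ord0 i)))//.
have <- := product_measure1E mu (power_measure mu n) (mA ord0) mB.
congr (product_measure1 _ _ _).
apply/seteqP; split=> [[x t] /= H|[x t] /= [Ax At] i].
  split=> [|i]; first exact: (H ord0).
  by have := H (lift ord0 i); rewrite tnthS.
by case: (unliftP ord0 i) => [j ->|->//]; rewrite tnthS.
Qed.

(* R^d. The library has Lebesgue measure on measurableTypeR R only; the tuple
   sigma-algebra generated by the coordinates is the Borel one. *)
Notation Rvec R d := (d.-tuple (measurableTypeR R)).

Definition lebesgue_Rvec (R : realType) (d : nat) :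
    {sigma_finite_measure set (Rvec R d) -> \bar R} :=
  power_measure (@lebesgue_measure R) d.

Section pdf.
Context (R : realType) (d : nat).

(* Densities are functions rather than a.e. classes, nonnegative everywhere. *)
Record pdf := Pdf {
  pdf_fun :> Rvec R d -> R;
  measurable_pdf : measurable_fun setT pdf_fun;
  pdf_ge0 : forall x, 0 <= pdf_fun x;
  integral_pdf : (\int[lebesgue_Rvec R d]_x (pdf_fun x)%:E = 1)%E }.

Variable f : pdf.

Definition pdf_prob (A : set (Rvec R d)) : \bar R :=
  (\int[lebesgue_Rvec R d]_(x in A) (f x)%:E)%E.

Let pdf_prob0 : pdf_prob set0 = 0%E.
Proof. exact: integral_set0. Qed.

Let pdf_prob_ge0 A : (0 <= pdf_prob A)%E.
Proof. by apply: integral_ge0 => x _; rewrite lee_fin pdf_ge0. Qed.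

Let pdf_prob_sigma_additive : semi_sigma_additive pdf_prob.
Proof.
apply: semi_sigma_additive_nng_induced => //.
- by apply/measurable_realfun.measurable_EFinP; exact: measurable_pdf.
- by move=> x; rewrite lee_fin pdf_ge0.
Qed.

HB.instance Definition _ := isMeasure.Build _ _ _ pdf_prob
  pdf_prob0 pdf_prob_ge0 pdf_prob_sigma_additive.

Let pdf_prob_setT : pdf_prob setT = 1%E.
Proof. exact: integral_pdf. Qed.

HB.instance Definition _ := Measure_isProbability.Build _ _ _ pdf_prob
  pdf_prob_setT.

(* The law of (X_1, ..., X_n) when the X_i are i.i.d. with density f. *)
Definition iid_law (n : nat) : set (n.-tuple (Rvec R d)) -> \bar R :=
  power_measure pdf_prob n.

HB.instance Definition _ (n : nat) := Measure.on (@iid_law n).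

Let iid_law_setT (n : nat) : @iid_law n setT = 1%E.
Proof. exact: power_measure_setT. Qed.

HB.instance Definition _ (n : nat) := Measure_isProbability.Build _ _ _
  (@iid_law n) (@iid_law_setT n).

End pdf.
Arguments iid_law {R d} f n.

Section nikolskii.
Context (R : realType) (d : nat).
Implicit Types (G : Rvec R d -> R) (x : Rvec R d).

Definition translate (u : R) (j : 'I_d) x : Rvec R d :=
  [tuple (tnth x i : R) + (if i == j then u else 0) | i < d].

Definition diff_op (u : R) (j : 'I_d) G : Rvec R d -> R :=
  fun x => G (translate u j x) - G x.

Definition nikolskii (r : 'I_d -> \bar R) (beta L : 'I_d -> R) :
    set (Rvec R d -> R) :=
  [set G | measurable_fun setT G /\ forall j : 'I_d,
    ('N[lebesgue_Rvec R d]_(r j)[EFin \o G] <= (L j)%:E)%E /\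
    exists k : nat, beta j < k%:R /\ forall u : R,
      ('N[lebesgue_Rvec R d]_(r j)[EFin \o iter k (diff_op u j) G]
         <= (L j * `|u| `^ beta j)%:E)%E].

Definition Psi (p : R) (f : Rvec R d -> R) : \bar R :=
  (\int[lebesgue_Rvec R d]_x (f x `^ p)%:E)%E.

Definition finite_Psi (p : R) : set (pdf R d) :=
  [set f | (`|Psi p f| < +oo)%E].

End nikolskii.

Section minimax.
Context (R : realType) (d n : nat).
Local Open Scope ereal_scope.

(* Only used for densities with Psi p f finite, where fine loses nothing. *)
Definition rmse (p : R) (F : n.-tuple (Rvec R d) -> R) (f : pdf R d) : \bar R :=
  'E_(iid_law f n)[(fun X => (F X - fine (Psi p f)) ^+ 2)%R] `^ 2^-1.

(* The supremum is taken in \bar R, so it is -oo when C is empty. *)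
Definition minimax_rmse (p : R) (C : set (pdf R d)) : \bar R :=
  ereal_inf [set ereal_sup [set rmse p F f | f in C] |
    F in [set F : n.-tuple (Rvec R d) -> R | measurable_fun setT F]].

End minimax.

(* Main.v *)
(* The class puts no control on tails, so Psi is unbounded on every neighbourhood
   of a fixed density and the minimax risk is infinite for every sample size.
   Let g_s be the product of d centred Gaussian densities of scale s. For s large,
   depending on (beta, L, r), all mixtures (g_s + g_S) / 2 with S >= s lie in the
   Nikolskii class: the k-th differences of g_s are O((|u| / s)^beta) uniformly and
   in L_1, hence in every L_r. Since g_s <= 2 (g_s + g_S) / 2, the law of n
   observations from g_s is at most 2^n times that from the mixture, for every S,
   whereas Psi((g_s + g_S) / 2) >= S^(1 - p) / 2 tends to infinity with S; no
   estimator can be accurate at both. *)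
Require Import Defs.
From HB Require Import structures.
From mathcomp Require Import all_boot all_order all_algebra.
From mathcomp Require Import all_classical all_reals all_analysis.
From mathcomp Require Import measurable_realfun ess_sup_inf.
From mathcomp Require Import ring lra.

Set Implicit Arguments.
Unset Strict Implicit.
Unset Printing Implicit Defensive.
Import Order.TTheory GRing.Theory Num.Theory.
Import numFieldNormedType.Exports.

Local Open Scope classical_set_scope.
Local Open Scope ring_scope.

(** * Integration against finite product measures *)

Section power_measure_integral.
Context d (T : measurableType d) (R : realType).
Implicit Types mu nu : {sigma_finite_measure set T -> \bar R}.
Local Open Scope ereal_scope.

(** Tonelli with the first coordinate outermost; this is what lets the proofs below go by induction
    on the number of coordinates. *)
Lemma ge0_integral_power_measureS mu n (F : n.+1.-tuple T -> \bar R) :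
  measurable_fun setT F -> (forall t, 0 <= F t) ->
  \int[power_measure mu n.+1]_t F t =
  \int[mu]_x \int[power_measure mu n]_t F (cons_pair (x, t)).
Proof.
move=> mF F0.
have mFc : measurable_fun setT (F \o @cons_pair _ T n).
  by apply: measurableT_comp => //; exact: measurable_cons_pair.
have -> := ge0_integral_pushforward (@measurable_cons_pair _ T n)
  (mu \x power_measure mu n)%E measurableT mF (fun t _ => F0 t).
by rewrite preimage_setT (fubini_tonelli1 (F \o @cons_pair _ T n) mFc) => [|z];
  [|exact: F0].
Qed.

Lemma measurable_power_measure_section mu n (F : n.+1.-tuple T -> \bar R) :
  measurable_fun setT F -> (forall t, 0 <= F t) ->
  measurable_fun setT
    (fun x => \int[power_measure mu n]_t F (cons_pair (x, t))).
Proof.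
move=> mF F0.
have mFc : measurable_fun setT (F \o @cons_pair _ T n).
  by apply: measurableT_comp => //; exact: measurable_cons_pair.
apply: (measurable_fun_fubini_tonelli_F (F \o @cons_pair _ T n) mFc) => z.
exact: F0.
Qed.

Lemma measurable_prod_tnth n (g : 'I_n -> T -> R) :
  (forall i, measurable_fun setT (g i)) ->
  measurable_fun setT (fun t : n.-tuple T => \prod_(i < n) g i (tnth t i))%R.
Proof.
move=> mg; apply: measurable_prod => i _.
by apply: measurableT_comp => //; exact: measurable_tnth.
Qed.

Lemma ge0_integral_power_measure_prod mu n (g : 'I_n -> T -> R) :
  (forall i, measurable_fun setT (g i)) -> (forall i x, (0 <= g i x)%R) ->
  \int[power_measure mu n]_t (\prod_(i < n) g i (tnth t i))%:E =
  \prod_(i < n) \int[mu]_x (g i x)%:E.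
Proof.
elim: n g => [|n ih] g mg g0.
  rewrite /= integral_dirac// ?diracT ?mul1e ?big_ord0//.
  by apply/measurable_EFinP; exact: measurable_prod_tnth.
rewrite ge0_integral_power_measureS; last 2 first.
- by apply/measurable_EFinP; exact: measurable_prod_tnth.
- by move=> t; rewrite lee_fin prodr_ge0.
pose h i := g (lift ord0 i).
have mh i : measurable_fun setT (h i) by exact: mg.
have h0 i x : (0 <= h i x)%R by exact: g0.
transitivity (\int[mu]_x ((g ord0 x)%:E * \prod_(i < n) \int[mu]_x (h i x)%:E)).
  apply: eq_integral => x _; rewrite -ih//.
  rewrite -ge0_integralZl//; last 3 first.
  - by apply/measurable_EFinP; exact: measurable_prod_tnth.
  - by move=> t _; rewrite lee_fin prodr_ge0.
  - by rewrite lee_fin.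
  apply: eq_integral => t _; rewrite big_ord_recl -EFinM; congr (_ * _)%:E.
  by apply: eq_bigr => i _; rewrite tnthS.
rewrite ge0_integralZr//; last 3 first.
- exact/measurable_EFinP.
- by move=> x _; rewrite lee_fin.
- by apply: prode_ge0 => i _; apply: integral_ge0 => x _; rewrite lee_fin.
by rewrite big_ord_recl.
Qed.

Lemma ge0_integral_le_scale (mu nu : {measure set T -> \bar R}) (c : {nonneg R})
    (F : T -> \bar R) :
  (forall A, measurable A -> mu A <= c%:num%:E * nu A) ->
  measurable_fun setT F -> (forall x, 0 <= F x) ->
  \int[mu]_x F x <= c%:num%:E * \int[nu]_x F x.
Proof.
move=> munu mF F0; rewrite -ge0_integral_mscale//.
by apply: ge0_le_measure_integral => // A mA; exact: munu.
Qed.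

(** Each coordinate costs one factor [c]: the induction hypothesis handles the inner integral, the
    one-coordinate comparison the outer one. The constant does not depend on [F], so this transfers
    the risk of any estimator from one sampling law to another. *)
Lemma ge0_integral_power_measure_le_scale mu nu (c : {nonneg R}) n
    (F : n.-tuple T -> \bar R) :
  (forall A, measurable A -> mu A <= c%:num%:E * nu A) ->
  measurable_fun setT F -> (forall t, 0 <= F t) ->
  \int[power_measure mu n]_t F t <=
  (c%:num ^+ n)%:E * \int[power_measure nu n]_t F t.
Proof.
move=> munu; elim: n F => [|n ih] F mF F0; first by rewrite expr0 mul1e.
have int_ge0 la x : 0 <= \int[power_measure la n]_t F (cons_pair (x, t)).
  exact: integral_ge0.
rewrite !ge0_integral_power_measureS//.
have mG := measurable_power_measure_section nu mF F0.
apply: (@le_trans _ _ (\int[mu]_x ((c%:num ^+ n)%:E *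
    \int[power_measure nu n]_t F (cons_pair (x, t))))).
  apply: ge0_le_integral => //.
  - exact: measurable_power_measure_section.
  - exact: measurable_funeM.
  - move=> x _; apply: ih => //.
    have mc := measurableT_comp (@measurable_cons_pair _ T n)
      (measurable_pair1 x).
    exact: (measurableT_comp mF mc).
rewrite ge0_integralZl//.
rewrite exprSr EFinM -muleA; apply: lee_wpmul2l.
  by rewrite lee_fin exprn_ge0.
exact: ge0_integral_le_scale.
Qed.

End power_measure_integral.

(** * Iterated finite differences in one variable *)

Section finite_differences.
Context (R : realType).
Implicit Types (g : R -> R) (t v : R).

Definition fwd_diff v g : R -> R := fun t => g (t + v) - g t.

Lemma fwd_diff_scale s v g k t :
  iter k (fwd_diff v) (fun t => g (t / s)) t =
  iter k (fwd_diff (v / s)) g (t / s).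
Proof.
elim: k t => //= k ih t.
by rewrite {1}/fwd_diff !ih /fwd_diff mulrDl.
Qed.

(** A crude bound for large steps. The two sums produced by one more difference run over the indices
    1 to k+1 and 0 to k; enlarging both to 0 to k+1 doubles the constant. *)
Lemma iter_fwd_diff_le v g k t :
  `|iter k (fwd_diff v) g t| <=
  2 ^+ k * \sum_(i < k.+1) `|g (t + i%:R * v)|.
Proof.
elim: k t => [|k ih] t.
  by rewrite big_ord1 expr0 mul1r mul0r addr0.
rewrite iterS {1}/fwd_diff; apply: le_trans (ler_normB _ _) _.
apply: le_trans (lerD (ih _) (ih _)) _.
rewrite -mulrDr exprSr -mulrA ler_pM2l ?exprn_gt0//.
rewrite [leRHS](_ : _ = \sum_(i < k.+2) `|g (t + i%:R * v)| +
  \sum_(i < k.+2) `|g (t + i%:R * v)|); last by rewrite mulr_natl.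
apply: lerD; last by rewrite [leRHS]big_ord_recr/= lerDl.
rewrite [leRHS]big_ord_recl/= ler_wpDl//.
apply: ler_sum => i _; rewrite /bump/= natrD mulrDl mul1r addrA.
by rewrite lexx.
Qed.

Lemma iter_fwd_diff_mvt (g : nat -> R -> R) v k t :
  (forall i (x : R), is_derive x 1 (g i) (g i.+1 x)) ->
  exists2 x, `|x - t| <= k%:R * `|v| &
    iter k (fwd_diff v) (g 0%N) t = v ^+ k * g k x.
Proof.
elim: k g => [|k ih] g dg.
  by exists t; rewrite ?subrr ?normr0 ?mul0r// expr0 mul1r.
have dDg i (x : R) : is_derive x 1 (fwd_diff v (g i)) (fwd_diff v (g i.+1) x).
  have dshift : is_derive x 1 (fun y : R => y + v) 1.
    by apply: trigger_derive; rewrite addr0.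
  have dgi : is_derive (x + v) 1 (g i) (g i.+1 (x + v)) by exact: dg.
  have dgv := @is_derive1_comp R (g i) (fun y => y + v) x _ _ dgi dshift.
  by have := is_deriveB dgv (dg i x); rewrite mulr1.
have [x xt E] := ih (fun i => fwd_diff v (g i)) dDg.
have cg i : continuous (g i).
  move=> y; apply/differentiable_continuous/derivable1_diffP.
  by have := dg i y => -[].
have [y yx Ey] : exists2 y, `|y - x| <= `|v| & fwd_diff v (g k) x = v * g k.+1 y.
  rewrite /fwd_diff; have [v0|v0] := leP 0 v.
    have xv : x <= x + v by rewrite lerDl.
    have [|y] := @MVT_segment R (g k) (g k.+1) x (x + v) xv.
      exact: continuous_subspaceT.
    rewrite in_itv/= => /andP[xy yxv] ->; exists y.
      by rewrite !ger0_norm ?subr_ge0//; rewrite lerBlDl.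
    by rewrite mulrC [x + v]addrC addrK.
  have xv : x + v <= x by rewrite gerDl ltW.
  have [|y] := @MVT_segment R (g k) (g k.+1) (x + v) x xv.
    exact: continuous_subspaceT.
  rewrite in_itv/= => /andP[xy yxv] H; exists y.
    by rewrite ler0_norm ?subr_le0// ltr0_norm// opprB lerBlDl lerBrDl addrC.
  by rewrite -opprB H opprD addrA subrr sub0r mulrN opprK mulrC.
exists y.
  have -> : y - t = (x - t) + (y - x) by ring.
  rewrite -[k.+1]addn1 natrD mulrDl mul1r.
  by apply: le_trans (ler_normD _ _) _; exact: lerD.
by rewrite iterSr E Ey exprSr mulrA.
Qed.

End finite_differences.

(** * Finite differences of the unnormalised Gaussian *)

Section gaussian_differences.
Context (R : realType).
Implicit Types (t v s : R).

Lemma normal_fun_scale s t : s != 0 -> normal_fun 0 s t = normal_fun 0 1 (t / s).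
Proof.
move=> s0; rewrite /normal_fun !subr0 expr1n expr_div_n; congr expR.
by rewrite -[in LHS]mulr_natr invfM mulrA !mulNr.
Qed.

(** Each multiplication by ['X] spends half of the exponent, hence the induction with [a]
    generalised. *)
Lemma horner_le_expR (P : {poly R}) (a : R) : 0 < a ->
  exists2 C, 0 <= C & forall t, `|P.[t]| <= C * expR (a * t ^+ 2).
Proof.
elim/poly_ind: P a => [|P c ih] a a0.
  by exists 0 => // t; rewrite horner0 normr0 mul0r.
have a20 : 0 < a / 2 by rewrite divr_gt0.
have [C C0 HC] := ih (a / 2) a20.
have C'0 : 0 <= C * (1 + 2 / a).
  by rewrite mulr_ge0// addr_ge0// divr_ge0// ltW.
(* The factor is chosen so that (1 + 2/a)(1 + a t^2/2) >= 1 + t^2 >= |t|, which pays for the new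
   ['X]. *)
exists (C * (1 + 2 / a) + `|c|); first by rewrite addr_ge0.
move=> t; rewrite hornerMXaddC mulrDl.
have e1 : 1 <= expR (a * t ^+ 2).
  by rewrite -expR0 ler_expR mulr_ge0 ?sqr_ge0// ltW.
apply: le_trans (ler_normD _ _) (lerD _ _); last by rewrite ler_peMr.
rewrite normrM (_ : a * t ^+ 2 = a / 2 * t ^+ 2 + a / 2 * t ^+ 2); last first.
  by rewrite -mulrDl -splitr.
rewrite expRD mulrACA; apply: ler_pM => //.
have /le_trans -> // : `|t| <= 1 + t ^+ 2.
  rewrite -[t ^+ 2]real_normK ?num_real//.
  have := sqr_ge0 (`|t| - 1 / 2); set u := `|t|; nra.
have et : 1 + a / 2 * t ^+ 2 <= expR (a / 2 * t ^+ 2) by exact: expR_ge1Dx.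
apply: le_trans (_ : (1 + 2 / a) * (1 + a / 2 * t ^+ 2) <= _); last first.
  by rewrite ler_pM2l// ltr_wpDr// divr_ge0// ltW.
have -> : (1 + 2 / a) * (1 + a / 2 * t ^+ 2) = 1 + a / 2 * t ^+ 2 + 2 / a + t ^+ 2.
  by field; rewrite gt_eqF.
have : 0 <= 2 / a by rewrite divr_ge0// ltW.
have : 0 <= a / 2 * t ^+ 2 by rewrite mulr_ge0 ?sqr_ge0// ltW.
lra.
Qed.

(* (-1)^k times the probabilists' Hermite polynomial. *)
Fixpoint hermite k : {poly R} :=
  if k is j.+1 then (hermite j)^`() - 'X * hermite j else 1.

Lemma is_derive_hermite k t :
  is_derive t 1 (fun x => (hermite k).[x] * normal_fun 0 1 x)
    ((hermite k.+1).[t] * normal_fun 0 1 t).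
Proof.
have dE : is_derive t 1 (normal_fun 0 1) (- t * normal_fun 0 1 t).
  pose h (x : R) := - (x - 0) ^+ 2 / (1 ^+ 2 *+ 2).
  have dh : is_derive t 1 h (- t).
    by apply: trigger_derive; rewrite /GRing.scale/=; field.
  have := @is_derive1_comp R expR h t _ _ (is_derive_expR _) dh.
  by rewrite mulrC.
have := is_deriveM (is_derive_poly (hermite k) t) dE.
congr is_derive; rewrite /= !hornerE /GRing.scale/=; ring.
Qed.

(** The mean value theorem evaluates the derivative at an unknown x near t; widening the scale from
    1 to 2 gives a bound in t. The polynomial costs exp(x^2/4), and the remaining exp(-x^2/4) is
    handled by t^2 <= 2x^2 + 2(x-t)^2, which is (2x-t)^2 >= 0. *)
Lemma hermite_normal_fun_le k (m : R) :
  exists2 C, 0 <= C & forall x t, `|x - t| <= m ->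
    `|(hermite k).[x] * normal_fun 0 1 x| <= C * normal_fun 0 2 t.
Proof.
have a0 : 0 < 4^-1 :> R by rewrite invr_gt0.
have [C C0 HC] := horner_le_expR (hermite k) a0.
exists (C * expR (m ^+ 2 / 4)); first by rewrite mulr_ge0 ?expR_ge0.
move=> x t xt; rewrite normrM (ger0_norm (normal_fun_ge0 _ _ _)).
apply: le_trans (ler_wpM2r (normal_fun_ge0 _ _ _) (HC x)) _.
rewrite -!mulrA ler_wpM2l// /normal_fun -!expRD ler_expR !subr0.
have : (x - t) ^+ 2 <= m ^+ 2.
  by rewrite -(real_normK (num_real (x - t))) ler_sqr ?nnegrE// (le_trans _ xt).
rewrite expr1n.
have := sqr_ge0 (2 * x - t).
lra.
Qed.

(* For |v| <= s the mean value theorem gives a bound by the term i = 0; for |v| > s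
   the triangle inequality suffices. *)
Lemma normal_fun_diff_le (b : R) k : 0 < b -> b < k%:R ->
  exists2 C, 0 <= C & forall s v t, 0 < s ->
    `|iter k (fwd_diff v) (normal_fun 0 s) t| <=
    C * (`|v| / s) `^ b * \sum_(i < k.+1) normal_fun (- (i%:R * v)) (2 * s) t.
Proof.
move=> b0 bk; have [C C0 HC] := hermite_normal_fun_le k k%:R.
exists (C + 2 ^+ k); first by rewrite addr_ge0.
move=> s v t s0.
have -> : normal_fun 0 s = (fun x => normal_fun 0 1 (x / s)).
  by apply/funext => x; rewrite normal_fun_scale ?gt_eqF.
rewrite fwd_diff_scale; set w := v / s.
have -> : `|v| / s = `|w| by rewrite normrM normfV (gtr0_norm s0).
have -> : \sum_(i < k.+1) normal_fun (- (i%:R * v)) (2 * s) t =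
    \sum_(i < k.+1) normal_fun 0 2 (t / s + i%:R * w).
  apply: eq_bigr => i _; rewrite /normal_fun subr0 opprK; congr expR.
  by rewrite /w; field; rewrite gt_eqF.
(* After rescaling, [s] enters only through t/s and v/s. *)
move: (t / s) w => {}t w.
have S0 : 0 <= \sum_(i < k.+1) normal_fun 0 2 (t + i%:R * w).
  by apply: sumr_ge0 => i _; exact: normal_fun_ge0.
rewrite mulrDl mulrDl.
have [w1|w1] := leP `|w| 1.
  apply: ler_wpDr; first by rewrite !mulr_ge0 ?powR_ge0.
  have -> : normal_fun 0 1 = (fun x => (hermite 0).[x] * normal_fun 0 1 x).
    by apply/funext => x; rewrite hornerC mul1r.
  have [x xt ->] := iter_fwd_diff_mvt w k t is_derive_hermite.
  rewrite normrM normrX mulrC.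
  (* At w = 0 both powers vanish, as b > 0 forces k > 0; otherwise |w| <= 1 and b < k. *)
  have wkb : `|w| ^+ k <= `|w| `^ b.
    have [->|w0] := eqVneq w 0.
      rewrite normr0 expr0n powR0 ?gt_eqF//.
      by case: k bk {C0 HC C S0 xt} => //; rewrite ltNge ltW.
    rewrite -powR_mulrn// ger_powR ?normr_gt0 ?w0//; last exact: ltW.
  rewrite mulrAC; apply: ler_pM => //.
  have xt1 : `|x - t| <= k%:R.
    by rewrite (le_trans xt)// ler_piMr.
  apply: le_trans (HC _ _ xt1) _.
  rewrite ler_wpM2l// big_ord_recl mul0r addr0 lerDl.
  by apply: sumr_ge0 => i _; exact: normal_fun_ge0.
apply: ler_wpDl; first by rewrite !mulr_ge0 ?powR_ge0.
apply: le_trans (iter_fwd_diff_le _ _ _ _) _.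
apply: ler_pM => //.
- exact: sumr_ge0.
- have : 1 `^ b <= `|w| `^ b by rewrite ge0_ler_powR ?nnegrE// ltW.
  by rewrite powR1 => wb; rewrite ler_peMr// exprn_ge0.
apply: ler_sum => i _; rewrite ger0_norm ?normal_fun_ge0//.
rewrite /normal_fun ler_expR !subr0 expr1n.
have := sqr_ge0 (t + i%:R * w); lra.
Qed.

End gaussian_differences.

(** * Norm bounds from the supremum and the integral *)

Section Lnorm_bound.
Context d (T : measurableType d) (R : realType) (mu : {measure set T -> \bar R}).
Implicit Types (G : T -> R) (M I L : R).

(** Interpolation: |G|^r <= M^(r-1) |G| pointwise. *)
Lemma Lnorm_fin_le G M I L (r : R) : measurable_fun setT G -> 1 <= r -> 0 <= L ->
  0 <= M -> (forall x, `|G x| <= M) -> (\int[mu]_x `|G x|%:E <= I%:E)%E ->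
  M `^ (r - 1) * I <= L `^ r ->
  ('N[mu]_(r%:E)[EFin \o G] <= L%:E)%E.
Proof.
move=> mG r1 L0 M0 GM GI MIL; rewrite unlock.
have r0 : 0 < r by exact: lt_le_trans r1.
have mG1 : measurable_fun setT (fun x => `|G x|) by exact: measurableT_comp.
rewrite (_ : L%:E = ((L `^ r)%:E `^ r^-1)%E); last first.
  by rewrite poweR_EFin -powRrM divff ?gt_eqF// powRr1.
apply: gt0_ler_poweR.
- by rewrite invr_ge0 ltW.
- by rewrite in_itv/= leey andbT integral_ge0// => x _; exact: poweR_ge0.
- by rewrite in_itv/= leey andbT lee_fin powR_ge0.
apply: (@le_trans _ _ (\int[mu]_x ((M `^ (r - 1))%:E * `|G x|%:E))%E).
  apply: ge0_le_integral => //.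
  - by move=> x _; exact: poweR_ge0.
  - apply: (eq_measurable_fun (fun x => (`|G x| `^ r)%:E)) => //.
    apply/measurable_EFinP.
    exact: (measurableT_comp (@measurable_powR R r) mG1).
  - by apply/measurable_EFinP; exact: measurable_funM.
  move=> x _; rewrite [X in (X <= _)%E]poweR_EFin -EFinM lee_fin.
  rewrite -(mulr_powRB1 (normr_ge0 (G x)) r0) mulrC ler_wpM2r//.
  by rewrite ge0_ler_powR ?nnegrE// subr_ge0.
rewrite ge0_integralZl//; last 2 first.
- exact/measurable_EFinP.
- by rewrite lee_fin powR_ge0.
apply: (@le_trans _ _ ((M `^ (r - 1))%:E * I%:E)%E); last by rewrite -EFinM lee_fin.
by apply: lee_wpmul2l => //; rewrite lee_fin powR_ge0.
Qed.

Lemma Lnorm_infty_le G L : 0 <= L -> (forall x, `|G x| <= L) ->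
  ('N[mu]_(+oo%E)[EFin \o G] <= L%:E)%E.
Proof.
move=> L0 GL; rewrite unlock; case: ifPn => _; last by rewrite lee_fin.
by apply/ess_supP/nearW => x /=; rewrite lee_fin.
Qed.

(** When both bounds equal M, M^(r-1) M = M^r, so interpolation loses no constant, whatever r is. *)
Lemma Lnorm_le_bound G M (r : \bar R) : measurable_fun setT G -> (1 <= r)%E ->
  0 <= M -> (forall x, `|G x| <= M) -> (\int[mu]_x `|G x|%:E <= M%:E)%E ->
  ('N[mu]_r[EFin \o G] <= M%:E)%E.
Proof.
case: r => [r| |//] mG r1 M0 GM GI; last exact: Lnorm_infty_le.
apply: (Lnorm_fin_le mG _ M0 M0 GM GI); first by rewrite -lee_fin.
by rewrite mulrC mulr_powRB1// (lt_le_trans _ (_ : 1 <= r))// -lee_fin.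
Qed.

(** For finite r > 1 the choice m = L^(r/(r-1)) gives m^(r-1) = L^r. At r = 1 a small supremum gains
    nothing: a density has norm exactly 1, hence the condition on L. *)
Lemma Lnorm_small_bound (L : R) (r : \bar R) : 0 < L -> (1 <= r)%E ->
  (r = 1%E -> 1 <= L) ->
  exists2 m, 0 < m & forall G, measurable_fun setT G ->
    (forall x, `|G x| <= m) -> (\int[mu]_x `|G x|%:E <= 1)%E ->
    ('N[mu]_r[EFin \o G] <= L%:E)%E.
Proof.
move=> L0; case: r => [r| |//] r1 rL; last first.
  by exists L => // G mG GL _; exact: Lnorm_infty_le (ltW L0) GL.
have [r1E|rneq1] := eqVneq r 1.
  exists 1 => // G mG G1 GI.
  apply: (Lnorm_fin_le mG _ (ltW L0) _ G1 GI) => //.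
  rewrite r1E subrr powRr0 mulr1 powRr1; last exact: ltW.
  by apply: rL; rewrite r1E.
have r1' : 0 < r - 1 by rewrite subr_gt0 lt_neqAle eq_sym rneq1 -lee_fin.
exists (L `^ (r / (r - 1))); first exact: powR_gt0.
move=> G mG Gm GI.
apply: (Lnorm_fin_le mG _ (ltW L0) _ Gm GI) => //; first exact: powR_ge0.
by rewrite mulr1 -powRrM divfK// gt_eqF.
Qed.

End Lnorm_bound.

(** * Directional differences of tensor products *)

Section product_difference.
Context (R : realType) (d : nat).
Implicit Types (g : 'I_d -> R -> R) (u : R) (j : 'I_d).

Definition tensor g : Rvec R d -> R := fun x => \prod_(i < d) g i (tnth x i).

Lemma measurable_tensor g : (forall i, measurable_fun setT (g i)) ->
  measurable_fun setT (tensor g).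
Proof. exact: measurable_prod_tnth. Qed.

(** A shift along coordinate [j] alters only the factor [j]; the other factors come out of the
    difference. *)
Lemma diff_op_tensor u j g :
  diff_op u j (tensor g) =
  tensor (fun i => if i == j then fwd_diff u (g i) else g i).
Proof.
apply/funext => x; rewrite /diff_op /tensor.
rewrite (bigD1 j)//= [X in _ - X](bigD1 j)//= [RHS](bigD1 j)//= eqxx.
rewrite tnth_mktuple eqxx /fwd_diff mulrBl; congr (_ * _ - _ * _).
  apply: eq_bigr => i ij.
  by rewrite tnth_mktuple (negPf ij) addr0.
by apply: eq_bigr => i ij; rewrite (negPf ij).
Qed.

Lemma iter_diff_op_tensor u j k g :
  iter k (diff_op u j) (tensor g) =
  tensor (fun i => if i == j then iter k (fwd_diff u) (g i) else g i).
Proof.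
elim: k g => [|k ih] g.
  by congr tensor; apply/funext => i; case: ifP.
rewrite iterSr diff_op_tensor ih; congr tensor.
by apply/funext => i; case: ifP => ij; rewrite ?ij ?iterSr.
Qed.

End product_difference.

(** * Product Gaussian densities: size, smoothness and [Psi] *)

Section gaussian_product.
Context (R : realType) (d : nat).
Implicit Types (s u v : R) (j : 'I_d).
Local Notation mu := (@lebesgue_measure R).
Local Notation muR := (lebesgue_Rvec R d).

Lemma ge0_integral_tensor (g : 'I_d -> R -> R) :
  (forall i, measurable_fun setT (g i)) -> (forall i x, 0 <= g i x) ->
  (\int[muR]_x (tensor g x)%:E = \prod_(i < d) \int[mu]_x (g i x)%:E)%E.
Proof.
move=> mg g0.
exact: (@ge0_integral_power_measure_prod _ (measurableTypeR R) R mu d g mg g0).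
Qed.

Lemma measurable_iter_fwd_diff k v (g : R -> R) : measurable_fun setT g ->
  measurable_fun setT (iter k (fwd_diff v) g).
Proof.
move=> mg; elim: k => //= k ih; apply: measurable_funB => //.
by apply: (measurableT_comp ih); exact: measurable_funD.
Qed.

Lemma normal_peakM (a s : R) : 0 < a -> normal_peak (a * s) = normal_peak s / a.
Proof.
move=> a0; rewrite /normal_peak exprMn -mulrA -mulrnAr sqrtrM ?sqr_ge0//.
by rewrite sqrtr_sqr gtr0_norm// invfM mulrC.
Qed.

Lemma normal_peak_le (s : R) : 0 < s -> normal_peak s <= s^-1.
Proof.
move=> s0; rewrite -{1}[s]mulr1 normal_peakM// ler_piMl ?invr_ge0 ?(ltW s0)//.
rewrite /normal_peak invf_le1 ?sqrtr_gt0.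
  rewrite -[leLHS]sqrtr1 ler_wsqrtr// expr1n mul1r mulr2n.
  by have := pi_ge2 R; lra.
by rewrite expr1n mul1r mulrn_wgt0// pi_gt0.
Qed.

Lemma normal_pdf_le1 (m s t : R) : 1 <= s -> normal_pdf m s t <= 1.
Proof.
move=> s1; have s0 : 0 < s by exact: lt_le_trans s1.
apply: le_trans (normal_pdf_ub _ _ _) _; first by rewrite gt_eqF.
by apply: le_trans (normal_peak_le s0) _; rewrite invf_le1.
Qed.

(** Normalised form, in which each summand on the right integrates to 1. The extra factor 2 is the
    ratio of the peaks at scales s and 2s. *)
Lemma normal_pdf_diff_le (b : R) k : 0 < b -> b < k%:R ->
  exists2 C, 0 <= C & forall s v t, 0 < s ->
    `|iter k (fwd_diff v) (normal_pdf 0 s) t| <=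
    C * (`|v| / s) `^ b * \sum_(i < k.+1) normal_pdf (- (i%:R * v)) (2 * s) t.
Proof.
move=> b0 bk; have [C C0 HC] := normal_fun_diff_le b0 bk.
exists (2 * C); first by rewrite mulr_ge0.
move=> s v t s0; have s20 : 0 < 2 * s by rewrite mulr_gt0.
have -> : iter k (fwd_diff v) (normal_pdf 0 s) t =
    normal_peak s * iter k (fwd_diff v) (normal_fun 0 s) t.
  rewrite normal_pdfE ?gt_eqF//.
  elim: k t {bk HC} => //= k ih t.
  by rewrite {1 3}/fwd_diff !ih mulrBr.
have -> : \sum_(i < k.+1) normal_pdf (- (i%:R * v)) (2 * s) t =
    normal_peak (2 * s) * \sum_(i < k.+1) normal_fun (- (i%:R * v)) (2 * s) t.
  by rewrite mulr_sumr; apply: eq_bigr => i _; rewrite normal_pdfE ?gt_eqF.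
rewrite normrM (ger0_norm (normal_peak_ge0 _)) normal_peakM//.
rewrite [leRHS](_ : _ = normal_peak s * (C * (`|v| / s) `^ b *
  \sum_(i < k.+1) normal_fun (- (i%:R * v)) (2 * s) t)); last by field.
by rewrite ler_wpM2l ?normal_peak_ge0// HC.
Qed.

Definition gauss s : Rvec R d -> R := tensor (fun=> normal_pdf 0 s).

Lemma measurable_gauss s : measurable_fun setT (gauss s).
Proof. by apply: measurable_tensor => i; exact: measurable_normal_pdf. Qed.

Lemma measurable_iter_diff_op_gauss k u j s :
  measurable_fun setT (iter k (diff_op u j) (gauss s)).
Proof.
rewrite iter_diff_op_tensor; apply: measurable_tensor => i.
case: ifP => _; last exact: measurable_normal_pdf.
by apply: measurable_iter_fwd_diff; exact: measurable_normal_pdf.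
Qed.

Lemma gauss_ge0 s x : 0 <= gauss s x.
Proof. by apply: prodr_ge0 => i _; exact: normal_pdf_ge0. Qed.

Lemma integral_gauss s : (\int[muR]_x (gauss s x)%:E = 1)%E.
Proof.
rewrite ge0_integral_tensor//; last 2 first.
- by move=> _; exact: measurable_normal_pdf.
- by move=> _ x; exact: normal_pdf_ge0.
by rewrite big1// => i _; exact: integral_normal_pdf.
Qed.

(** One coordinate supplies 1/s and the others are at most 1, so the supremum tends to 0 as the
    scale grows. *)
Lemma gauss_le_inv s x : (0 < d)%N -> 1 <= s -> gauss s x <= s^-1.
Proof.
move=> d0 s1; have s0 : 0 < s by exact: lt_le_trans s1.
rewrite /gauss /tensor (bigD1 (Ordinal d0))//=.
rewrite -[leRHS]mulr1; apply: ler_pM.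
- exact: normal_pdf_ge0.
- by apply: prodr_ge0 => i _; exact: normal_pdf_ge0.
- by apply: le_trans (normal_pdf_ub _ _ _) (normal_peak_le s0); rewrite gt_eqF.
- by apply: prodr_ile1 => i; rewrite normal_pdf_ge0 normal_pdf_le1.
Qed.

(** The dominating function [h] is again a tensor product, with only factor [j] changed. The sum of
    k+1 normal densities in that factor is at most k+1 and integrates to k+1, so one constant serves
    both bounds. *)
Lemma gauss_diff_le (b : R) k : 0 < b -> b < k%:R ->
  exists2 K, 0 <= K & forall s u j, 1 <= s ->
    (forall x, `|iter k (diff_op u j) (gauss s) x| <= K * (`|u| / s) `^ b) /\
    (\int[muR]_x `|iter k (diff_op u j) (gauss s) x|%:E <=
       (K * (`|u| / s) `^ b)%:E)%E.
Proof.
move=> b0 bk; have [C C0 HC] := normal_pdf_diff_le b0 bk.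
exists (C * k.+1%:R); first by rewrite mulr_ge0.
move=> s u j s1; have s0 : 0 < s by exact: lt_le_trans s1.
set A := C * (`|u| / s) `^ b.
have A0 : 0 <= A by rewrite mulr_ge0 ?powR_ge0.
pose S t := \sum_(i < k.+1) normal_pdf (- (i%:R * u)) (2 * s) t.
have S0 t : 0 <= S t by apply: sumr_ge0 => i _; exact: normal_pdf_ge0.
have mS : measurable_fun setT S.
  by apply: measurable_sum => i; exact: measurable_normal_pdf.
pose h (i : 'I_d) := if i == j then fun t => A * S t else normal_pdf 0 s.
have h0 i t : 0 <= h i t.
  by rewrite /h; case: ifP => _; [exact: mulr_ge0|exact: normal_pdf_ge0].
have mh i : measurable_fun setT (h i).
  rewrite /h; case: ifP => _; last exact: measurable_normal_pdf.
  exact: measurable_funM.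
have le_h x : `|iter k (diff_op u j) (gauss s) x| <= tensor h x.
  rewrite iter_diff_op_tensor /tensor normr_prod.
  apply: ler_prod => i _; rewrite normr_ge0 /h/=; case: ifP => _; first exact: HC.
  by rewrite ger0_norm ?normal_pdf_ge0.
have prodE (c : R) : \prod_(i < d) (if i == j then c else 1) = c.
  by rewrite -big_mkcond/= big_pred1_eq.
have -> : C * k.+1%:R * (`|u| / s) `^ b = A * k.+1%:R by rewrite /A mulrAC.
split=> [x|].
  apply: le_trans (le_h x) _; rewrite -[leRHS]prodE.
  apply: ler_prod => i _; rewrite h0 /h; case: ifP => _.
    rewrite ler_wpM2l// /S -[k.+1 in leRHS]card_ord -sum1_card natr_sum.
    apply: ler_sum => l _; apply: normal_pdf_le1; lra.
  exact: normal_pdf_le1.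
apply: (@le_trans _ _ (\int[muR]_x (tensor h x)%:E)%E).
  apply: ge0_le_integral => //.
  - apply/measurable_EFinP; apply: measurableT_comp => //.
    exact: measurable_iter_diff_op_gauss.
  - by apply/measurable_EFinP; exact: measurable_tensor.
  - by move=> x _; rewrite lee_fin.
rewrite ge0_integral_tensor//.
rewrite (eq_bigr (fun i => (if i == j then A * k.+1%:R else 1)%:E)) => [|i _].
  by rewrite prodEFin prodE.
rewrite /h; case: ifP => _; last exact: integral_normal_pdf.
transitivity (\int[mu]_t (A%:E * \sum_(l < k.+1)
    (normal_pdf (- (l%:R * u)) (2 * s) t)%:E))%E.
  by apply: eq_integral => t _; rewrite sumEFin.
rewrite ge0_integralZl//; last 2 first.
- apply: emeasurable_sum => l; apply/measurable_EFinP.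
  exact: measurable_normal_pdf.
- by move=> t _; apply: sume_ge0 => l _; rewrite lee_fin normal_pdf_ge0.
rewrite ge0_integral_sum//; last 2 first.
- by move=> l; apply/measurable_EFinP; exact: measurable_normal_pdf.
- by move=> l t _; rewrite lee_fin normal_pdf_ge0.
under eq_bigr do rewrite integral_normal_pdf.
by rewrite sumEFin sumr_const card_ord EFinM.
Qed.

(* Coordinatewise, [gauss s ^ p] is a multiple of the Gaussian density of scale
   s / sqrt p. *)
Lemma Psi_gauss (p s : R) : 0 < p -> p < 1 -> (0 < d)%N -> 1 <= s ->
  exists2 c, s `^ (1 - p) <= c & Psi p (gauss s) = c%:E.
Proof.
move=> p0 p1 d0 s1; have s0 : 0 < s by exact: lt_le_trans s1.
have q0 : 0 < Num.sqrt p by rewrite sqrtr_gt0.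
pose s' := (Num.sqrt p)^-1 * s.
have s'0 : s' != 0 by rewrite gt_eqF// mulr_gt0// invr_gt0.
have pk0 : 0 < normal_peak s by rewrite normal_peak_gt0// gt_eqF.
have pk0' : 0 < normal_peak s' by rewrite normal_peak_gt0.
pose c := normal_peak s `^ p / normal_peak s'.
have c0 : 0 <= c by rewrite divr_ge0 ?powR_ge0 ?ltW.
have pdfE t : normal_pdf 0 s t `^ p = c * normal_pdf 0 s' t.
  have pE r : r != 0 -> normal_pdf 0 r t = normal_peak r * normal_fun 0 r t.
    by move=> r0; rewrite normal_pdfE.
  rewrite !pE ?(gt_eqF s0)// powRM ?normal_peak_ge0 ?normal_fun_ge0//.
  rewrite /c mulrA divfK ?gt_eqF//; congr (_ * _).
  rewrite /normal_fun -expRM; congr expR.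
  rewrite /s' exprMn exprVn sqr_sqrtr ?ltW//; field.
  by rewrite !gt_eqF.
have prod_powR (I : Type) (r : seq I) (F : I -> R) : (forall i, 0 <= F i) ->
    (\prod_(i <- r) F i) `^ p = \prod_(i <- r) F i `^ p.
  move=> F0; elim: r => [|i r ih]; first by rewrite !big_nil powR1.
  by rewrite !big_cons powRM// ?ih// prodr_ge0.
exists (c ^+ d); last first.
  transitivity (\int[muR]_x (tensor (fun=> fun t => c * normal_pdf 0 s' t) x)%:E)%E.
    apply: eq_integral => x _; rewrite /gauss /tensor prod_powR => [|i].
      by congr EFin; apply: eq_bigr => i _; rewrite pdfE.
    exact: normal_pdf_ge0.
  rewrite ge0_integral_tensor//; last 2 first.
  - by move=> _; apply: measurable_funM => //; exact: measurable_normal_pdf.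
  - by move=> _ t; rewrite mulr_ge0// normal_pdf_ge0.
  rewrite (eq_bigr (fun=> c%:E)) => [|i _]; last first.
    under eq_integral do rewrite EFinM.
    rewrite ge0_integralZl//; last 2 first.
    - by apply/measurable_EFinP; exact: measurable_normal_pdf.
    - by move=> t _; rewrite lee_fin normal_pdf_ge0.
    by rewrite integral_normal_pdf mule1.
  by rewrite prodEFin prodr_const card_ord.
(* Here c = (1 / peak(s))^(1-p) / sqrt p, where 1 / peak(s) >= s and sqrt p <= 1. *)
have sc : s `^ (1 - p) <= c.
  have ps : s <= (normal_peak s)^-1.
    rewrite -[leRHS]div1r ler_pdivlMr// mulrC -ler_pdivlMr// div1r.
    exact: normal_peak_le.
  have -> : c = ((normal_peak s)^-1) `^ (1 - p) / Num.sqrt p.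
    rewrite /c normal_peakM ?invr_gt0// invrK invfM mulrA; congr (_ / _).
    rewrite powRB; last by rewrite invr_eq0 gt_eqF ?implybT.
    have pk1 : (normal_peak s)^-1 `^ 1 = (normal_peak s)^-1.
      by rewrite powRr1// invr_ge0 ltW.
    rewrite pk1 [RHS]mulrC; congr (_ * _).
    have -> : (normal_peak s)^-1 = normal_peak s `^ (-1).
      by rewrite powR_inv1// ltW.
    by rewrite -powRrM mulN1r powRN invrK.
  apply: (@le_trans _ _ ((normal_peak s)^-1 `^ (1 - p))).
    apply: ge0_ler_powR => //.
    - by rewrite subr_ge0 ltW.
    - exact: ltW.
    - by rewrite nnegrE invr_ge0 ltW.
  rewrite ler_peMr ?powR_ge0// invf_ge1//.
  by rewrite -sqrtr1 ler_wsqrtr// ltW.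
(* This makes c^d >= c, so a single coordinate already gives the lower bound. *)
have c1 : 1 <= c.
  apply: (le_trans _ sc).
  by rewrite -[leLHS](powRr0 s) ler_powR// subr_ge0 ltW.
apply: le_trans sc _.
by case: d d0 => // m _; rewrite exprS ler_peMr// exprn_ege1.
Qed.

End gaussian_product.

(** * Mixtures of two Gaussian densities *)

Section mixture.
Context (R : realType) (d : nat).
Implicit Types (s S u p : R) (j : 'I_d) (G H : Rvec R d -> R).
Local Notation muR := (lebesgue_Rvec R d).

Definition average G H : Rvec R d -> R := fun x => (G x + H x) / 2.

Lemma measurable_average G H : measurable_fun setT G -> measurable_fun setT H ->
  measurable_fun setT (average G H).
Proof. by move=> mG mH; apply: measurable_funM => //; exact: measurable_funD. Qed.

Lemma iter_diff_op_average k u j G H :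
  iter k (diff_op u j) (average G H) =
  average (iter k (diff_op u j) G) (iter k (diff_op u j) H).
Proof.
elim: k => //= k ->; apply/funext => x.
by rewrite /diff_op /average; ring.
Qed.

Lemma ge0_integral_average G H :
  measurable_fun setT G -> measurable_fun setT H ->
  (forall x, 0 <= G x) -> (forall x, 0 <= H x) ->
  (\int[muR]_x (average G H x)%:E =
   2^-1%:E * (\int[muR]_x (G x)%:E + \int[muR]_x (H x)%:E))%E.
Proof.
move=> mG mH G0 H0; have /measurable_EFinP mG' := mG.
have /measurable_EFinP mH' := mH.
rewrite -ge0_integralD//; last 2 first.
- by move=> x _; rewrite lee_fin.
- by move=> x _; rewrite lee_fin.
rewrite -ge0_integralZl//; last 2 first.
- exact: emeasurable_funD.
- by move=> x _; rewrite lee_fin addr_ge0.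
by apply: eq_integral => x _; rewrite /average mulrC EFinM EFinD.
Qed.

Lemma average_bound G H (M : R) : (forall x, `|G x| <= M) ->
  (forall x, `|H x| <= M) -> forall x, `|average G H x| <= M.
Proof.
move=> GM HM x; rewrite /average normrM normfV (ger0_norm (ler0n _ 2)).
rewrite ler_pdivrMr// mulr_natr mulr2n.
exact: le_trans (ler_normD _ _) (lerD (GM x) (HM x)).
Qed.

Lemma average_integral_bound G H (M : R) :
  measurable_fun setT G -> measurable_fun setT H ->
  (\int[muR]_x `|G x|%:E <= M%:E)%E -> (\int[muR]_x `|H x|%:E <= M%:E)%E ->
  (\int[muR]_x `|average G H x|%:E <= M%:E)%E.
Proof.
move=> mG mH GM HM.
have mG1 : measurable_fun setT (fun x => `|G x|) by exact: measurableT_comp.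
have mH1 : measurable_fun setT (fun x => `|H x|) by exact: measurableT_comp.
apply: (@le_trans _ _ (\int[muR]_x
    (average (fun x => `|G x|) (fun x => `|H x|) x)%:E)%E).
  apply: ge0_le_integral => //.
  - apply/measurable_EFinP; apply: measurableT_comp => //.
    exact: measurable_average.
  - by apply/measurable_EFinP; exact: measurable_average.
  - move=> x _; rewrite lee_fin /average normrM (ger0_norm (_ : 0 <= 2^-1))//.
    by rewrite ler_wpM2r// ler_normD.
rewrite ge0_integral_average//.
rewrite (_ : M%:E = (2^-1%:E * (M%:E + M%:E))%E); last first.
  by rewrite -EFinD -EFinM; congr EFin; field.
by apply: lee_wpmul2l => //; exact: leeD.
Qed.

Let gauss_mix_fun s S := average (@gauss R d s) (gauss S).

Let measurable_gauss_mix s S : measurable_fun setT (gauss_mix_fun s S).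
Proof. by apply: measurable_average; exact: measurable_gauss. Qed.

Let gauss_mix_ge0 s S x : 0 <= gauss_mix_fun s S x.
Proof. by rewrite divr_ge0// addr_ge0 ?gauss_ge0. Qed.

Let integral_gauss_mix s S : (\int[muR]_x (gauss_mix_fun s S x)%:E = 1)%E.
Proof.
rewrite ge0_integral_average ?integral_gauss; last 4 first.
- exact: measurable_gauss.
- exact: measurable_gauss.
- exact: gauss_ge0.
- exact: gauss_ge0.
by rewrite -EFinD -EFinM; congr EFin; field.
Qed.

Definition gauss_mix s S : pdf R d :=
  Pdf (measurable_gauss_mix s S) (gauss_mix_ge0 s S) (integral_gauss_mix s S).

(** Size and smoothness are checked on each component separately and survive averaging, so the
    threshold leaves [S] free to tend to infinity with [s] fixed. *)
Lemma gauss_mix_nikolskii (d_gt0 : (0 < d)%N) (beta L : 'I_d -> R)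
    (r : 'I_d -> \bar R) :
  (forall j, 0 < beta j) -> (forall j, 0 < L j) -> (forall j, (1 <= r j)%E) ->
  (forall j, r j = 1%E -> 1 <= L j) ->
  exists2 s0, 1 <= s0 & forall s S, s0 <= s -> s0 <= S ->
    nikolskii r beta L (gauss_mix s S).
Proof.
move=> b0 L0 r1 rL.
have gauss1 s : (\int[muR]_x `|@gauss R d s x|%:E <= 1)%E.
  rewrite -(@integral_gauss R d s) le_eqVlt; apply/orP; left; apply/eqP.
  by apply: eq_integral => x _; rewrite ger0_norm ?gauss_ge0.
suff /choice[t Ht] : forall j, exists t, forall s S, 1 <= s -> 1 <= S ->
    t <= s -> t <= S ->
    ('N[muR]_(r j)[EFin \o gauss_mix s S] <= (L j)%:E)%E /\
    exists k : nat, beta j < k%:R /\ forall u : R,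
      ('N[muR]_(r j)[EFin \o iter k (diff_op u j) (gauss_mix s S)]
         <= (L j * `|u| `^ beta j)%:E)%E.
  (* A common threshold above 1 and above every [t j]. *)
  exists (1 + \sum_(j < d) `|t j|).
    by rewrite lerDl sumr_ge0.
  move=> s S s0s s0S.
  have le1 : 1 <= 1 + \sum_(j < d) `|t j| by rewrite lerDl sumr_ge0.
  have let_ j : t j <= 1 + \sum_(j < d) `|t j|.
    rewrite (bigD1 j)//= addrCA ler_wpDr ?ler_norm// addr_ge0//.
    exact: sumr_ge0.
  split; first exact: measurable_gauss_mix.
  by move=> j; apply: Ht; apply: le_trans s0s || apply: le_trans s0S.
move=> j.
have [m m0 Hm] := Lnorm_small_bound muR (L0 j) (r1 j) (rL j).
pose k := (Num.truncn (beta j)).+1.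
have bk : beta j < k%:R by rewrite /k truncnS_gt.
have [K K0 HK] := gauss_diff_le d (b0 j) bk.
(* The first entry forces 1/s <= m, the second K / s^beta <= L. *)
exists (Num.max m^-1 ((K / L j) `^ (beta j)^-1)) => s S s1 S1.
rewrite !ge_max => /andP[ms Ks] /andP[mS KS].
have s0 : 0 < s by exact: lt_le_trans s1.
have S0 : 0 < S by exact: lt_le_trans S1.
split.
  apply: Hm; first exact: measurable_gauss_mix.
    apply: average_bound => x; rewrite ger0_norm ?gauss_ge0//.
      apply: le_trans (gauss_le_inv _ d_gt0 s1) _.
      by rewrite -[leRHS]invrK lef_pV2// posrE ?invr_gt0.
    apply: le_trans (gauss_le_inv _ d_gt0 S1) _.
    by rewrite -[leRHS]invrK lef_pV2// posrE ?invr_gt0.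
  by apply: average_integral_bound => //; exact: measurable_gauss.
exists k; split=> // u.
have M0 : 0 <= L j * `|u| `^ beta j by rewrite mulr_ge0 ?powR_ge0 ?ltW.
have KL x : 1 <= x -> (K / L j) `^ (beta j)^-1 <= x ->
    K * (`|u| / x) `^ beta j <= L j * `|u| `^ beta j.
  move=> x1 Kx; have x0 : 0 < x by exact: lt_le_trans x1.
  have xb0 : 0 < x `^ beta j by exact: powR_gt0.
  have -> : (`|u| / x) `^ beta j = `|u| `^ beta j / x `^ beta j.
    rewrite powRM ?invr_ge0 ?(ltW x0)//; congr (_ * _).
    have -> : x^-1 = x `^ (-1) by rewrite powR_inv1// ltW.
    by rewrite powRAC powR_inv1// powR_ge0.
  rewrite mulrCA mulrC ler_wpM2r ?powR_ge0// ler_pdivrMr//.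
  rewrite mulrC -ler_pdivrMr//.
  have KL0 : 0 <= K / L j by rewrite divr_ge0// ltW.
  rewrite -[leLHS]powRr1// -(@mulVf _ (beta j)) ?gt_eqF// powRrM.
  by rewrite ge0_ler_powR ?nnegrE ?powR_ge0 ?(ltW x0) ?(ltW (b0 j)).
rewrite iter_diff_op_average.
have [Hs1 Hs2] := HK s u j s1; have [HS1 HS2] := HK S u j S1.
have ms' := @measurable_iter_diff_op_gauss R d k u j s.
have mS' := @measurable_iter_diff_op_gauss R d k u j S.
apply: Lnorm_le_bound => //.
- exact: measurable_average.
- apply: average_bound => x.
    by apply: le_trans (Hs1 x) _; exact: KL.
  by apply: le_trans (HS1 x) _; exact: KL.
- apply: average_integral_bound => //.
    by apply: le_trans Hs2 _; rewrite lee_fin KL.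
  by apply: le_trans HS2 _; rewrite lee_fin KL.
Qed.

(** With a, b the two component values, (a+b)/2 is at most max(a, b), whence the upper bound a^p +
    b^p. For the lower one it is at least b/2, and (1/2)^p >= 1/2. *)
Lemma Psi_gauss_mix p s S : 0 < p -> p < 1 -> (0 < d)%N -> 1 <= s -> 1 <= S ->
  finite_Psi p (gauss_mix s S) /\
  S `^ (1 - p) / 2 <= fine (Psi p (gauss_mix s S)).
Proof.
move=> p0 p1 d0 s1 S1.
have [c cS Ec] := Psi_gauss p0 p1 d0 S1.
have [c' _ Ec'] := Psi_gauss p0 p1 d0 s1.
have mp G : measurable_fun setT G -> measurable_fun setT (fun x => (G x `^ p)%:E).
  move=> mG; apply/measurable_EFinP.
  exact: (measurableT_comp (@measurable_powR R p) mG).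
have mg := @measurable_gauss R d.
have le_up : (Psi p (gauss_mix s S) <= (c' + c)%:E)%E.
  rewrite EFinD -Ec -Ec' /Psi -ge0_integralD//; last 4 first.
  - by move=> x _; rewrite lee_fin powR_ge0.
  - exact: mp.
  - by move=> x _; rewrite lee_fin powR_ge0.
  - exact: mp.
  apply: ge0_le_integral => //.
  - by move=> x _; rewrite lee_fin powR_ge0.
  - exact: mp (measurable_gauss_mix s S).
  - by apply: emeasurable_funD; exact: mp.
  move=> x _; rewrite -EFinD lee_fin /= /gauss_mix_fun /average.
  have := @gauss_ge0 R d s x; have := @gauss_ge0 R d S x.
  move: (gauss s x) (gauss S x) => a b b0 a0.
  have [ab|/ltW ab] := leP a b.
    apply: ler_wpDl; first exact: powR_ge0.
    by apply: ge0_ler_powR; rewrite ?nnegrE; lra.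
  apply: ler_wpDr; first exact: powR_ge0.
  by apply: ge0_ler_powR; rewrite ?nnegrE; lra.
have le_lo : ((c / 2)%:E <= Psi p (gauss_mix s S))%E.
  rewrite mulrC EFinM -Ec /Psi -ge0_integralZl//; last 2 first.
  - exact: mp (mg S).
  - by move=> x _; rewrite lee_fin powR_ge0.
  apply: ge0_le_integral => //.
  - by move=> x _; rewrite mule_ge0// lee_fin powR_ge0.
  - by apply: measurable_funeM; exact: mp.
  - exact: mp (measurable_gauss_mix s S).
  move=> x _; rewrite -EFinM lee_fin /= /gauss_mix_fun /average.
  have := @gauss_ge0 R d s x; have := @gauss_ge0 R d S x.
  move: (gauss s x) (gauss S x) => a b b0 a0.
  apply: (@le_trans _ _ ((2^-1 * b) `^ p)); last first.
    by apply: ge0_ler_powR; rewrite ?nnegrE; lra.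
  rewrite powRM// ler_wpM2r ?powR_ge0//.
  apply: ger1_powR; last exact: ltW.
  by rewrite invr_gt0 ltr0n invf_le1 ?ler1n.
have Psi0 : (0 <= Psi p (gauss_mix s S))%E.
  by apply: integral_ge0 => x _; rewrite lee_fin powR_ge0.
have fin : Psi p (gauss_mix s S) \is a fin_num.
  by rewrite ge0_fin_numE// (le_lt_trans le_up) ?ltry.
split; first by rewrite /finite_Psi/= gee0_abs// (le_lt_trans le_up) ?ltry.
rewrite -lee_fin fineK//; apply: le_trans le_lo.
by rewrite lee_fin ler_wpM2r.
Qed.

End mixture.

(** * Two-point argument by change of measure *)

Section two_point_bound.
Context (R : realType) (d n : nat) (p : R).
Implicit Types (f : pdf R d) (F : n.-tuple (Rvec R d) -> R) (A : R).

Lemma integral_sqr_le_rmse f F A : (rmse p F f <= A%:E)%E ->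
  (\int[iid_law f n]_X ((F X - fine (Psi p f)) ^+ 2)%:E <= (A ^+ 2)%:E)%E.
Proof.
rewrite /rmse unlock; set I := (integral _ _ _) => IA.
have I0 : (0 <= I)%E by apply: integral_ge0 => X _; rewrite lee_fin sqr_ge0.
have A0 : 0 <= A by rewrite -lee_fin (le_trans _ IA)// poweR_ge0.
have -> : I = ((I `^ 2^-1) `^ 2)%E by rewrite -poweRrM mulVf// poweRe1.
rewrite -powR_mulrn// -poweR_EFin.
by apply: gt0_ler_poweR => //; rewrite in_itv/= leey ?poweR_ge0// lee_fin A0.
Qed.

Lemma pdf_prob_le_scale f (g : pdf R d) (c : {nonneg R}) :
  (forall x, f x <= c%:num * g x) ->
  forall B, measurable B -> (pdf_prob f B <= c%:num%:E * pdf_prob g B)%E.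
Proof.
move=> fg B mB; have mE h : measurable_fun B (fun x => (pdf_fun h x)%:E).
  by apply/measurable_EFinP; apply: measurable_funTS; exact: measurable_pdf.
rewrite /pdf_prob -ge0_integralZl//; last by move=> x _; rewrite lee_fin pdf_ge0.
apply: ge0_le_integral => //.
- by move=> x _; rewrite lee_fin pdf_ge0.
- by apply: measurable_funeM; exact: (mE g).
- by move=> x _; rewrite -EFinM lee_fin.
Qed.

(* If [f0 <= c * f1] then [n] observations from [f0] have a law at most [c ^ n]
   times that from [f1], however far apart [Psi p f0] and [Psi p f1] are. *)
Lemma minimax_rmse_eqy (C : set (pdf R d)) f0 (c : {nonneg R}) : C f0 ->
  (forall B : R, exists f1, [/\ C f1, forall x, f0 x <= c%:num * f1 x &
    B <= fine (Psi p f1)]) ->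
  minimax_rmse n p C = +oo%E.
Proof.
move=> Cf0 H; apply/eqP; rewrite -leye_eq.
apply/ereal_infP => _ [F mF <-]; rewrite leye_eq; apply/eqP/eq_infty => A.
rewrite leNgt; apply/negP => supA.
have rA f : C f -> (rmse p F f <= A%:E)%E.
  move=> Cf; apply: le_trans (ltW supA).
  by apply: le_ereal_sup_tmp; exists (rmse p F f); first by exists f.
have A0 : 0 <= A by rewrite -lee_fin (le_trans _ (rA _ Cf0))// poweR_ge0.
(* Under [f0], (P1-P0)^2 <= 2(F-P0)^2 + 2(F-P1)^2 has expectation at most 2A^2 + 2c^n A^2 = W
   A^2. *)
pose W := 2 + 2 * c%:num ^+ n.
have W2 : 2 <= W by rewrite lerDl mulr_ge0// exprn_ge0.
(* This gap contradicts that bound, since W^2 (A+1)^2 > W A^2. *)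
have [f1 [Cf1 f01]] := H (fine (Psi p f0) + W * (A + 1)).
set P0 := fine (Psi p f0); set P1 := fine (Psi p f1) => P01.
pose E (f g : pdf R d) : \bar R :=
  (\int[iid_law f n]_X ((F X - fine (Psi p g)) ^+ 2)%:E)%E.
have mE (g : pdf R d) :
    measurable_fun setT (fun X => ((F X - fine (Psi p g)) ^+ 2)%:E).
  by apply/measurable_EFinP; apply: measurable_funX; exact: measurable_funB.
have E00 : (E f0 f0 <= (A ^+ 2)%:E)%E by apply/integral_sqr_le_rmse/rA.
have E11 : (E f1 f1 <= (A ^+ 2)%:E)%E by apply/integral_sqr_le_rmse/rA.
have E01 : (E f0 f1 <= (c%:num ^+ n * A ^+ 2)%:E)%E.
  apply: (@le_trans _ _ ((c%:num ^+ n)%:E * E f1 f1)%E).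
    apply: ge0_integral_power_measure_le_scale => //.
    - exact: pdf_prob_le_scale.
    - by move=> X; rewrite lee_fin sqr_ge0.
  by rewrite EFinM; apply: lee_wpmul2l => //; rewrite lee_fin exprn_ge0.
have : (((P1 - P0) ^+ 2)%:E <= (W * A ^+ 2)%:E)%E.
  apply: (@le_trans _ _ (2%:E * (E f0 f0 + E f0 f1))%E); last first.
    rewrite (_ : W * A ^+ 2 = 2 * (A ^+ 2 + c%:num ^+ n * A ^+ 2)); last first.
      by rewrite /W; ring.
    rewrite EFinM (EFinD (A ^+ 2)); apply: lee_wpmul2l; first by rewrite lee_fin.
    exact: leeD.
  rewrite /E -ge0_integralD//; last 2 first.
  - by move=> X _; rewrite lee_fin sqr_ge0.
  - by move=> X _; rewrite lee_fin sqr_ge0.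
  rewrite -ge0_integralZl//; last 2 first.
  - exact: emeasurable_funD.
  - by move=> X _; rewrite lee_fin addr_ge0 ?sqr_ge0.
  (* The constant (P1-P0)^2 is its own expectation under the law of the sample. *)
  rewrite -[leLHS]mule1 -(probability_setT (iid_law f0 n)) -integral_cst//.
  apply: ge0_le_integral => //.
  - by move=> X _; rewrite lee_fin sqr_ge0.
  - by apply: measurable_funeM; exact: emeasurable_funD.
  - move=> X _; rewrite -EFinD -EFinM lee_fin -/P0 -/P1.
    have := sqr_ge0 ((F X - P0) + (F X - P1)); nra.
apply/negP; rewrite -ltNge lte_fin.
clearbody W.
have WA0 : 0 <= W * (A + 1) by rewrite mulr_ge0//; lra.
have WP : W * (A + 1) <= P1 - P0 by lra.
apply: (@lt_le_trans _ _ ((W * (A + 1)) ^+ 2)); last first.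
  by rewrite ler_sqr ?nnegrE// (le_trans WA0).
rewrite exprMn expr2 -mulrA ltr_pM2l; last by lra.
apply: (@lt_le_trans _ _ ((A + 1) ^+ 2)); first by nra.
by rewrite ler_peMl ?sqr_ge0//; lra.
Qed.

End two_point_bound.

Theorem theorem6 (R : realType) (d : nat) (d_gt0 : (0 < d)%N)
    (p : R) (p_gt0 : 0 < p) (p_lt1 : p < 1) :
  exists2 c : R, 0 < c &
  forall (beta L : 'I_d -> R) (r : 'I_d -> \bar R),
    (forall j, 0 < beta j) -> (forall j, 0 < L j) ->
    (forall j, (1 <= r j)%E) ->
    (forall j, r j = 1%E -> 1 <= L j) ->
    (c%:E <= limn_einf (fun n : nat =>
       (ln n%:R `^ (2 * p))%:E *
       minimax_rmse n p
         (finite_Psi p `&` [set f : pdf R d | nikolskii r beta L f])))%E.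
Proof.
(* Any positive constant would do, as the lower limit is infinite. *)
exists 1 => // beta L r b0 L0 r1 rL.
set C := (finite_Psi p `&` _).
have [s s1 Hs] := gauss_mix_nikolskii d_gt0 b0 L0 r1 rL.
have Cmix S : s <= S -> C (gauss_mix d s S).
  move=> sS; split; last exact: Hs.
  by have [] := Psi_gauss_mix p_gt0 p_lt1 d_gt0 s1 (le_trans s1 sS).
have infty n : minimax_rmse n p C = +oo%E.
  (* Mixing [gauss s] with itself gives it back as a [pdf]; it is at most twice any mixture
     containing it. *)
  apply: (@minimax_rmse_eqy _ _ _ _ _ (gauss_mix d s s) 2%:nng); first exact: Cmix.
  (* The second entry solves S^(1-p) / 2 = |B|. *)
  move=> B; pose S := Num.max s ((2 * `|B|) `^ (1 - p)^-1).
  have sS : s <= S by rewrite le_max lexx.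
  have S1 := le_trans s1 sS.
  have [_ PsiS] := Psi_gauss_mix p_gt0 p_lt1 d_gt0 s1 S1.
  exists (gauss_mix d s S); split.
  - exact: Cmix.
  - move=> x; rewrite /= /average.
    have := @gauss_ge0 R d s x; have := @gauss_ge0 R d S x; lra.
  - apply: le_trans PsiS; rewrite ler_pdivlMr// mulrC.
    apply: (@le_trans _ _ (2 * `|B|)); first by rewrite ler_wpM2l// ler_norm.
    have B0 : 0 <= 2 * `|B| by rewrite mulr_ge0.
    have p1 : 0 < 1 - p by rewrite subr_gt0.
    rewrite [leLHS](_ : _ = ((2 * `|B|) `^ (1 - p)^-1) `^ (1 - p)); last first.
      by rewrite -powRrM mulVf ?gt_eqF// powRr1.
    rewrite ge0_ler_powR ?nnegrE ?powR_ge0 ?(ltW p1)//.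
      by rewrite (le_trans _ S1).
    by rewrite le_max lexx orbT.
rewrite (_ : limn_einf _ = +oo%E) ?leey//.
have cvgy : (fun n : nat => (ln n%:R `^ (2 * p))%:E * minimax_rmse n p C)%E
    @ \oo --> (+oo%E : \bar R).
  (* From n = 2 on the logarithm is positive; at n = 1 the product is 0 times infinity, which is
     0. *)
  apply: cvg_near_cst; exists 2%N => // n /= n2.
  by rewrite infty gt0_muley// lte_fin powR_gt0// ln_gt0// ltr1n.
by have [] := cvg_limn_einf_sup cvgy.
Qed.
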